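(* \begin{enumerate} \item[(i)] Let $G$ be a finite abelian group and let $F$ be either the field of rational numbers or an algebraic extension of the rationals. Then $FG$ has no nonzero derivations. \item[(ii)] Let $p$ be a prime, $n\ge 1$ an integer, $F=\mathbb{F}_{p^n}$ the finite field with $p^n$ elements, and let $H$ be a $p$-regular subgroup of a finite abelian group $G$. Then all derivations of $FG$ are $FH$-derivations. \end{enumerate}
   Context: $FG$ is the group algebra of $G$ over $F$, and $FH\subseteq FG$ is the group algebra of $H$. A derivation of a ring $A$ is a map $d\colon A\to A$ with $d(a+b)=d(a)+d(b)$ and $d(ab)=d(a)b+a\,d(b)$ for all $a,b\in A$ (not assumed $F$-linear). A derivation $d$ of $FG$ is an $FH$-derivation if $d(FH)=\{0\}$. A group is $p$-regular if none of its elements has order divisible by $p$. *)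

(* Defs.v *)
From HB Require Import structures.
From mathcomp Require Import all_boot all_order all_algebra all_fingroup.

Set Implicit Arguments.
Unset Strict Implicit.
Unset Printing Implicit Defensive.

Import GRing.Theory.
Local Open Scope ring_scope.

(* An element of FG is its coefficient function, a standing for
   \sum_x (a x) x.  This must be a new name for {ffun gT -> F}: the library
   equips {ffun gT -> F} itself with the pointwise product, whereas the product
   of the group algebra is convolution. *)
Definition group_algebra (F : fieldType) (gT : finGroupType) : Type :=
  {ffun gT -> F}.

HB.instance Definition _ (F : fieldType) (gT : finGroupType) :=
  GRing.Lmodule.copy (group_algebra F gT) {ffun gT -> F^o}.

Section GroupAlgebra.

Variables (F : fieldType) (gT : finGroupType).
Implicit Types (a b c : group_algebra F gT) (k : F) (g x y : gT).

Definition ga_coef a x : F := (a : {ffun gT -> F}) x.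

Definition ga_elt g : group_algebra F gT := [ffun x => (x == g)%:R].

Definition ga_mul a b : group_algebra F gT :=
  [ffun x => \sum_(y : gT) ga_coef a y * ga_coef b (y^-1 * x)%g].

Lemma ga_coefP a b : ga_coef a =1 ga_coef b -> a = b.
Proof. by move=> eq_ab; apply/ffunP. Qed.

Lemma ga_coefD a b x : ga_coef (a + b) x = ga_coef a x + ga_coef b x.
Proof. exact: ffunE. Qed.

Lemma ga_coefZ k a x : ga_coef (k *: a) x = k * ga_coef a x.
Proof. exact: ffunE. Qed.

Lemma ga_coef0 x : ga_coef 0 x = 0.
Proof. exact: ffunE. Qed.

Lemma ga_coef_elt g x : ga_coef (ga_elt g) x = (x == g)%:R.
Proof. exact: ffunE. Qed.

Lemma ga_coef_mul a b x :
  ga_coef (ga_mul a b) x = \sum_(y : gT) ga_coef a y * ga_coef b (y^-1 * x)%g.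
Proof. exact: ffunE. Qed.

Lemma ga_mul_eltl g a x : ga_coef (ga_mul (ga_elt g) a) x = ga_coef a (g^-1 * x)%g.
Proof.
rewrite ga_coef_mul (bigD1 g) //= ga_coef_elt eqxx mul1r big1 ?addr0 // => y.
by rewrite ga_coef_elt => /negbTE->; rewrite mul0r.
Qed.

Fact ga_mulA : associative ga_mul.
Proof.
move=> a b c; apply: ga_coefP => x; rewrite !ga_coef_mul.
under eq_bigr do rewrite ga_coef_mul mulr_sumr.
under [RHS]eq_bigr do rewrite ga_coef_mul mulr_suml.
rewrite [RHS]exchange_big; apply: eq_bigr => y _ /=.
rewrite [RHS](reindex_inj (mulgI y)); apply: eq_bigr => z _ /=.
by rewrite mulrA mulKg invMg mulgA.
Qed.

Fact ga_mul1r : left_id (ga_elt 1%g) ga_mul.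
Proof. by move=> a; apply: ga_coefP => x; rewrite ga_mul_eltl invg1 mul1g. Qed.

Fact ga_mulr1 : right_id (ga_elt 1%g) ga_mul.
Proof.
move=> a; apply: ga_coefP => x; rewrite ga_coef_mul (bigD1 x) //= ga_coef_elt.
rewrite mulVg eqxx mulr1 big1 ?addr0 // => y /negbTE neq_yx.
by rewrite ga_coef_elt -eq_mulVg1 neq_yx mulr0.
Qed.

Fact ga_mulDl : left_distributive ga_mul +%R.
Proof.
move=> a b c; apply: ga_coefP => x; rewrite ga_coefD !ga_coef_mul -big_split.
by apply: eq_bigr => y _; rewrite ga_coefD mulrDl.
Qed.

Fact ga_mulDr : right_distributive ga_mul +%R.
Proof.
move=> a b c; apply: ga_coefP => x; rewrite ga_coefD !ga_coef_mul -big_split.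
by apply: eq_bigr => y _; rewrite ga_coefD mulrDr.
Qed.

Fact ga_elt1_neq0 : ga_elt 1%g != 0.
Proof.
apply/eqP => /(congr1 (ga_coef^~ 1%g)).
by rewrite ga_coef_elt ga_coef0 eqxx => /eqP; rewrite oner_eq0.
Qed.

HB.instance Definition _ := GRing.Zmodule_isNzRing.Build (group_algebra F gT)
  ga_mulA ga_mul1r ga_mulr1 ga_mulDl ga_mulDr ga_elt1_neq0.

Fact ga_scaleAl k a b : k *: (a * b) = (k *: a) * b.
Proof.
apply: ga_coefP => x; rewrite ga_coefZ !ga_coef_mul mulr_sumr.
by apply: eq_bigr => y _; rewrite ga_coefZ mulrA.
Qed.

Fact ga_scaleAr k a b : k *: (a * b) = a * (k *: b).
Proof.
apply: ga_coefP => x; rewrite ga_coefZ !ga_coef_mul mulr_sumr.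
by apply: eq_bigr => y _; rewrite ga_coefZ mulrCA.
Qed.

HB.instance Definition _ :=
  GRing.Lmodule_isLalgebra.Build F (group_algebra F gT) ga_scaleAl.
HB.instance Definition _ :=
  GRing.Lalgebra_isAlgebra.Build F (group_algebra F gT) ga_scaleAr.

Lemma ga_eltM g x : ga_elt (g * x)%g = ga_elt g * ga_elt x.
Proof.
apply: ga_coefP => y; rewrite ga_mul_eltl !ga_coef_elt.
by rewrite -(inj_eq (mulgI g^-1%g)) mulKg.
Qed.

Lemma ga_sum_elt a : a = \sum_(x : gT) ga_coef a x *: ga_elt x.
Proof.
apply: ga_coefP => y.
rewrite (big_morph (ga_coef^~ y) (fun b c => ga_coefD b c y) (ga_coef0 y)).
rewrite (bigD1 y) //= ga_coefZ ga_coef_elt eqxx mulr1 big1 ?addr0 // => x.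
by rewrite ga_coefZ ga_coef_elt eq_sym => /negbTE->; rewrite mulr0.
Qed.

(* FH is identified with the elements of FG supported in H. *)
Definition subgroup_algebra (H : {group gT}) : {pred group_algebra F gT} :=
  [pred a : group_algebra F gT | [forall x, (ga_coef a x != 0) ==> (x \in H)]].

End GroupAlgebra.

Arguments ga_elt F {gT} g.
Arguments subgroup_algebra F {gT} H.

Definition is_derivation (A : pzRingType) (d : A -> A) : Prop :=
  (forall a b, d (a + b) = d a + d b) /\
  (forall a b, d (a * b) = d a * b + a * d b).

(* As 0 \in FH, vanishing on FH is the same as d(FH) = {0}. *)
Definition is_FH_derivation (F : fieldType) (gT : finGroupType)
    (H : {group gT}) (d : group_algebra F gT -> group_algebra F gT) : Prop :=
  is_derivation d /\ (forall a, a \in subgroup_algebra F H -> d a = 0).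

Definition p_regular (p : nat) (gT : finGroupType) (H : {group gT}) : Prop :=
  forall x, x \in H -> ~~ (p %| #[x]%g)%N.

Definition algebraic_extension_of_rat (F : fieldType) : Prop :=
  exists iota : {rmorphism rat -> F}, forall x : F, algebraicOver iota x.

Lemma rat_algebraic_extension_of_rat : algebraic_extension_of_rat rat.
Proof. by exists idfun => x; apply: (@algebraic_id _ _ idfun). Qed.

(* Main.v *)
Require Import Defs.
From HB Require Import structures.
From mathcomp Require Import all_boot all_order all_algebra all_fingroup.
From mathcomp Require Import cyclic finfield.

Set Implicit Arguments.
Unset Strict Implicit.
Unset Printing Implicit Defensive.

Import GRing.Theory Num.Theory.
Local Open Scope ring_scope.

(** A derivation of FG that kills the scalars and the group elements in the
    support of a kills a, by the product rule, so it is enough to treat these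
    two kinds of elements.

    Scalars: each coefficient of k |-> d (k 1) is a derivation of the field F
    ([derivation_coef_scalar]), and F has none but 0. If F is algebraic over
    the rationals, d vanishes on the rationals, and differentiating a
    polynomial relation p(x) = 0 gives p'(x) d(x) = 0, where p' is nonzero and
    has smaller degree than p ([derivation_algebraic]). If F is finite of order
    q, then x = x^q and q = 0 in F, so d(x) = q x^(q-1) d(x) = 0
    ([derivation_finField]).

    Group elements: since FG is commutative, g^m = 1 gives
    m g^(m-1) d(g) = 0, and g^(m-1) is invertible; so d(g) = 0 as soon as the
    order m of g is nonzero in F ([derivation_elt]). This is the case for every
    g in characteristic 0, and for every g in a p-regular subgroup in
    characteristic p. *)

Section RingDerivation.

Variables (A : pzRingType) (d : A -> A).
Hypothesis der_d : is_derivation d.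

Lemma derivation0 : d 0 = 0.
Proof. by apply: (@addrI _ (d 0)); rewrite -der_d.1 !addr0. Qed.

Lemma derivation1 : d 1 = 0.
Proof.
apply: (@addrI _ (d 1)); rewrite addr0 -[RHS](congr1 d (mulr1 1)) der_d.2.
by rewrite mulr1 mul1r.
Qed.

Lemma derivationMn a n : d (a *+ n) = d a *+ n.
Proof.
by elim: n => [|n IHn]; rewrite ?mulr0n ?derivation0 // !mulrS der_d.1 IHn.
Qed.

(** The ring is not taken commutative, so that the lemma applies to the group
    algebra, whose commutativity comes from a hypothesis on the group. *)
Lemma derivationX a n :
  GRing.comm a (d a) -> d (a ^+ n.+1) = (a ^+ n * d a) *+ n.+1.
Proof.
move=> comm_a; elim: n => [|n IHn]; first by rewrite expr0 mul1r.
rewrite exprS der_d.2 IHn -mulrnAr mulrA -exprS mulrnAr [RHS]mulrS; congr (_ + _).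
exact/commrX/commr_sym.
Qed.

End RingDerivation.

Section FieldDerivation.

Variables (F : fieldType) (d : F -> F).
Hypothesis der_d : is_derivation d.

(** Additivity and d 1 = 0 give d z = 0 for integers z; then q * denq q = numq q
    gives d q * denq q = 0, where the denominator stays nonzero in F because a
    field morphism is injective. *)
Lemma derivation_rat (iota : {rmorphism rat -> F}) q : d (iota q) = 0.
Proof.
have d_nat n : d n%:R = 0 by rewrite derivationMn // derivation1 // mul0rn.
have d_int z : d z%:~R = 0.
  case: z => n; first exact: d_nat.
  apply: (@addrI _ (d n.+1%:R)).
  by rewrite -der_d.1 NegzE mulrNz subrr derivation0 // d_nat addr0.
have /(congr1 (d \o iota)) /= : q * (denq q)%:~R = (numq q)%:~R.
  by rewrite -{1}(divq_num_den q) divfK // intr_eq0 denq_neq0.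
rewrite rmorphM !rmorph_int der_d.2 !d_int mulr0 addr0 => /eqP.
rewrite mulf_eq0 -(rmorph_int iota) fmorph_eq0 intr_eq0.
by rewrite (negPf (denq_neq0 q)) orbF => /eqP.
Qed.

Lemma derivation_horner (K : fieldType) (iota : {rmorphism K -> F}) x p :
    (forall c, d (iota c) = 0) ->
  d (map_poly iota p).[x] = (map_poly iota p^`()).[x] * d x.
Proof.
move=> d_iota; elim/poly_ind: p => [|p c IHp].
  by rewrite deriv0 rmorph0 horner0 mul0r derivation0.
rewrite derivD derivC addr0 derivM derivX mulr1 !rmorphD !rmorphM /=.
rewrite map_polyX map_polyC !hornerE der_d.1 d_iota addr0 der_d.2 IHp.
by rewrite [RHS]mulrDl; congr (_ + _); rewrite mulrAC.
Qed.

(** Differentiating p(x) = 0 gives p'(x) d(x) = 0. If p'(x) = 0, then p' is a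
    relation for x of smaller degree, nonzero since the characteristic is 0;
    this descent, an induction on the size of p, replaces the choice of a
    minimal polynomial. *)
Lemma derivation_algebraic (K : numFieldType) (iota : {rmorphism K -> F}) x :
    (forall c, d (iota c) = 0) -> algebraicOver iota x ->
  d x = 0.
Proof.
move=> d_iota [p].
have [n] := ubnP (size p); elim: n p => // n IHn p /ltnSE-le_p_n nz_p root_p.
have gt1_p : (1 < size p)%N.
  rewrite -(size_map_poly iota).
  by apply: root_size_gt1 root_p; rewrite map_poly_eq0.
(* The leading coefficient of p^`() is that of p times the degree of p. *)
have nz_p' : p^`() != 0.
  apply/eqP=> /(congr1 (fun q : {poly K} => q`_(size p).-2)) /eqP.
  rewrite coef_deriv coef0 prednK -?subn1 ?subn_gt0 // subn1 mulrn_eq0.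
  rewrite -/(lead_coef p) lead_coef_eq0 (negPf nz_p) orbF.
  by rewrite -subn1 subn_eq0 leqNgt gt1_p.
have [root_p'|nz_p'x] := boolP (root (map_poly iota p^`()) x).
  by apply: IHn root_p' => //; apply: leq_trans (lt_size_deriv nz_p) le_p_n.
have /eqP := derivation_horner x p d_iota.
rewrite (rootP root_p) derivation0 // eq_sym mulf_eq0 -rootE (negPf nz_p'x).
exact: eqP.
Qed.

End FieldDerivation.

(** Every element is a power with exponent #|F|, which is 0 in F. *)
Lemma derivation_finField (F : finFieldType) (d : F -> F) :
  is_derivation d -> forall x, d x = 0.
Proof.
move=> der_d x; have card_gt0 := ltnW (finNzRing_gt1 F).
(* Lagrange in the additive group of F. *)
have card0 : #|F|%:R = 0 :> F.
  by have := expg_cardG (in_setT (1 : F)); rewrite cardsT FinRing.zmodXgE.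
rewrite -(expf_card x) -(prednK card_gt0) derivationX //; last exact: mulrC.
by rewrite prednK // -mulr_natl card0 mul0r.
Qed.

Section GroupAlgebraDerivation.

Variables (F : fieldType) (gT : finGroupType).
Hypothesis abG : abelian [set: gT].
Local Notation FG := (group_algebra F gT).

Lemma ga_mulC (a b : FG) : a * b = b * a.
Proof.
apply: ga_coefP => x; rewrite !ga_coef_mul.
rewrite (reindex_inj (mulgI x)) (reindex_inj invg_inj) /=.
apply: eq_bigr => y _; rewrite invMg invgK mulgKV mulrC; congr (_ * ga_coef a _).
by apply: (centsP abG); rewrite inE.
Qed.

Lemma ga_eltX (g : gT) n : ga_elt F (g ^+ n)%g = ga_elt F g ^+ n.
Proof. by elim: n => // n IHn; rewrite expgS ga_eltM IHn exprS. Qed.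

Variable d : FG -> FG.
Hypothesis der_d : is_derivation d.

(** Differentiating g ^+ m = 1 for m the order of g gives m g^(m-1) d(g) = 0;
    multiplying by g turns g^(m-1) into 1. *)
Lemma derivation_elt (g : gT) : #[g]%g%:R != 0 :> F -> d (ga_elt F g) = 0.
Proof.
move=> nz_g; have := congr1 d (ga_eltX g #[g]%g).
rewrite expg_order (derivation1 der_d) -(prednK (order_gt0 g)).
rewrite derivationX //; last exact: ga_mulC.
move=> /(congr1 ( *%R (ga_elt F g))); rewrite mulr0 -mulrnAr mulrA -exprS prednK //.
rewrite -ga_eltX expg_order mul1r -scaler_nat => /esym/eqP.
by rewrite scaler_eq0 (negPf nz_g) => /eqP.
Qed.

(** As d need not be F-linear, d (k 1) may a priori be nonzero. Reading off one
    coefficient at a time reduces the question to derivations of F itself. *)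
Lemma derivation_coef_scalar x :
  is_derivation (fun k : F => ga_coef (d k%:A) x).
Proof.
split=> k l; first by rewrite scalerDl der_d.1 ga_coefD.
have -> : (k * l)%:A = k%:A * l%:A :> FG by rewrite -scalerAl mul1r scalerA.
rewrite der_d.2 ga_coefD mulrC -!ga_coefZ -scalerAl -scalerAr.
by rewrite mulr1 mul1r.
Qed.

(** The common form of both results: in a = \sum_x a_x x only the x with
    a_x != 0 contribute, so only their orders have to be nonzero in F. *)
Lemma derivation_ga a :
    (forall delta : F -> F, is_derivation delta -> forall k, delta k = 0) ->
    (forall x, ga_coef a x != 0 -> #[x]%g%:R != 0 :> F) ->
  d a = 0.
Proof.
move=> der0 supp_a.
have d_scalar k : d k%:A = 0.
  by apply: ga_coefP => x; rewrite (der0 _ (derivation_coef_scalar x)) ga_coef0.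
rewrite [a]ga_sum_elt (big_morph d der_d.1 (derivation0 der_d)).
rewrite big1 // => x _; rewrite -[ga_elt F x]mul1r scalerAl der_d.2 d_scalar.
rewrite mul0r add0r -scalerAl mul1r.
have [->|/supp_a/derivation_elt->] := eqVneq (ga_coef a x) 0.
  by rewrite scale0r.
by rewrite scaler0.
Qed.

End GroupAlgebraDerivation.

Theorem corollary3p2 :
  (forall (gT : finGroupType) (F : fieldType)
          (hG : abelian [set: gT]) (hF : algebraic_extension_of_rat F)
          (d : group_algebra F gT -> group_algebra F gT),
      is_derivation d -> forall a, d a = 0)
  /\
  (forall (p n : nat) (hp : prime p) (hn : (1 <= n)%N)
          (F : finFieldType) (hF : #|F| = (p ^ n)%N)
          (gT : finGroupType) (hG : abelian [set: gT])
          (H : {group gT}) (hH : p_regular p H)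
          (d : group_algebra F gT -> group_algebra F gT),
      is_derivation d -> is_FH_derivation H d).
Proof.
split=> [gT F abG [iota algF] d der_d a|p n p_prime _ F cardF gT abG H regH d der_d].
  apply: (derivation_ga abG der_d) => [delta der_delta k|x _].
    exact: (derivation_algebraic der_delta (derivation_rat der_delta iota)).
  by rewrite -(rmorph_nat iota) fmorph_eq0 pnatr_eq0 -lt0n order_gt0.
split=> // a /forallP supp_a.
apply: (derivation_ga abG der_d) => [|x /(implyP (supp_a x)) Hx].
  exact: derivation_finField.
by rewrite -(dvdn_pcharf (card_finPcharP cardF p_prime)) regH.
Qed.
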